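(* Let $X$ and $Y$ be real vector spaces, and let $f:X\to Y$ be a function. Then $f$ satisfies $$f(2x+y)+f(2x-y)=4\bigl(f(x+y)+f(x-y)\bigr)-\frac{3}{7}\bigl(f(2y)-2f(y)\bigr)+2f(2x)-8f(x)$$ for all $x,y\in X$ if and only if there exist a unique symmetric multi-additive function $B:X\times X\times X\times X\to Y$ and a unique additive function $A:X\to Y$ such that $f(x)=B(x,x,x,x)+A(x)$ for all $x\in X$.
   Context: A function $A:X\to Y$ is additive if $A(x+y)=A(x)+A(y)$ for all $x,y\in X$. A function $B:X\times X\times X\times X\to Y$ is multi-additive if it is additive in each of its four variables when the other three are fixed, and symmetric if its value is unchanged under every permutation of its four arguments. *)

(* Defs.v *)
From mathcomp Require Import all_boot all_order all_algebra all_fingroup.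
From mathcomp Require Import reals.
Set Implicit Arguments.
Unset Strict Implicit.
Unset Printing Implicit Defensive.
Import GRing.Theory.
Local Open Scope ring_scope.

(* The paper's notion asks only for preservation of +, whereas
   [{additive X -> Y}] bundles further structure. *)
Definition is_additive (X Y : zmodType) (A : X -> Y) : Prop :=
  {morph A : x y / x + y}.

Definition is_multi_additive (X Y : zmodType) (B : X -> X -> X -> X -> Y) :
    Prop :=
  [/\ forall y z w, is_additive (fun x => B x y z w),
      forall x z w, is_additive (fun y => B x y z w),
      forall x y w, is_additive (fun z => B x y z w) &
      forall x y z, is_additive (fun w => B x y z w)].

Definition apply4 (X Y : Type) (B : X -> X -> X -> X -> Y) (v : 'I_4 -> X) : Y :=
  B (v (inord 0)) (v (inord 1)) (v (inord 2)) (v (inord 3)).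

Definition is_symmetric4 (X Y : Type) (B : X -> X -> X -> X -> Y) : Prop :=
  forall (s : 'S_4) (v : 'I_4 -> X), apply4 B (v \o s) = apply4 B v.

Definition functional_equation (R : realType) (X Y : lmodType R) (f : X -> Y) :
    Prop :=
  forall x y : X,
    f (2 *: x + y) + f (2 *: x - y) =
      4 *: (f (x + y) + f (x - y))
      - (3 / 7 : R) *: (f (2 *: y) - 2 *: f y)
      + 2 *: f (2 *: x) - 8 *: f x.

(* Main.v *)
(* Even and odd parts of a solution are again solutions.  For an odd solution,
   the second differences along a line obey the recurrences
   t_(k+1) + t_(k-1) = - 3/2 t_k and, by rescaling, t_(k+1) + t_(k-1) = 1/4 t_k,
   so they vanish and the solution is additive.  For an even solution f, the
   equation writes 24 f(x) as a sum of five terms c g(y + a x); eliminating them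
   one at a time shows that all fifth differences of f vanish, so that the
   fourth difference at 0, divided by 24, is additive in each increment.  On the
   diagonal it returns f because f(k x) = k^4 f(x) for k = 2, 3, 4.  Uniqueness
   is polarization: the fourth difference of B(t,t,t,t) + A(t) is 24 B. *)
Require Import Defs.
From mathcomp Require Import all_boot all_order all_algebra all_fingroup.
From mathcomp Require Import reals boolp lra.
Import GRing.Theory.
Set Implicit Arguments.
Unset Strict Implicit.
Unset Printing Implicit Defensive.
Local Open Scope ring_scope.

(** * Linear identities in a module, decided by reflection *)

Inductive lterm (R : Type) : Type :=
| LVar of nat
| LZero
| LAdd of lterm R & lterm R
| LOpp of lterm R
| LScale of R & lterm R.

Fixpoint leval (R : realType) (V : lmodType R) (env : seq V) (t : lterm R) :
    V :=
  match t with
  | LVar i => nth 0 env i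
  | LZero => 0
  | LAdd t u => leval env t + leval env u
  | LOpp t => - leval env t
  | LScale a t => a *: leval env t
  end.

Fixpoint lcoef (R : realType) (t : lterm R) (i : nat) : R :=
  match t with
  | LVar j => (j == i)%:R
  | LZero => 0
  | LAdd t u => lcoef t i + lcoef u i
  | LOpp t => - lcoef t i
  | LScale a t => a * lcoef t i
  end.

(** Recursion on the bound makes this unfold to a finite conjunction of scalar equations, one per
    atom, which [lra] can close. *)
Fixpoint lcoef_eq (R : realType) (t u : lterm R) (n : nat) : Prop :=
  if n is n'.+1 then lcoef t n' = lcoef u n' /\ lcoef_eq t u n' else True.

Lemma levalE (R : realType) (V : lmodType R) (env : seq V) (t : lterm R) :
  leval env t = \sum_(i < size env) lcoef t i *: env`_i.
Proof.
elim: t => /= [j||t -> u ->|t ->|a t ->].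
- have [jlt|jge] := ltnP j (size env).
    rewrite (bigD1 (Ordinal jlt)) //= eqxx scale1r big1 ?addr0 // => i.
    by rewrite -val_eqE /= eq_sym => /negbTE ->; rewrite scale0r.
  (* An index beyond [env] evaluates to the default 0, matching the empty contribution to the
     sum. *)
  rewrite nth_default // big1 // => i _.
  by rewrite gtn_eqF ?scale0r // (leq_trans (ltn_ord i)).
- by rewrite big1 // => i _; rewrite scale0r.
- by rewrite -big_split; apply: eq_bigr => i _; rewrite scalerDl.
- by rewrite -sumrN; apply: eq_bigr => i _; rewrite scaleNr.
- by rewrite scaler_sumr; apply: eq_bigr => i _; rewrite scalerA.
Qed.

Lemma leval_eq (R : realType) (V : lmodType R) (env : seq V) (t u : lterm R) :
  lcoef_eq t u (size env) -> leval env t = leval env u.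
Proof.
rewrite !levalE => tu; apply: eq_bigr => -[i /= ilt] _; congr (_ *: _).
elim: (size env) ilt tu => //= n IHn; rewrite ltnS leq_eqVlt.
by case/predU1P => [-> []|ilt [_]] //; apply: IHn.
Qed.

(* Atoms are compared up to conversion, because equal vectors may carry
   syntactically different structure instances. *)
Ltac atom_index a env :=
  match env with
  | ?b :: _ => let _ := match goal with _ => unify a b end in constr:(Some 0%N)
  | _ :: ?env' => lazymatch atom_index a env' with
                  | Some ?n => constr:(Some n.+1)
                  | None => constr:(@None nat)
                  end
  | nil => constr:(@None nat)
  end.
Ltac add_atoms t env :=
  lazymatch t with
  | ?a + ?b => let env := add_atoms a env in add_atoms b env
  | - ?a => add_atoms a env
  | _ *: ?a => add_atoms a env
  | 0 => env
  | _ => lazymatch atom_index t env with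
         | Some _ => env
         | None => constr:(t :: env)
         end
  end.
Ltac reify_lterm R t env :=
  lazymatch t with
  | ?a + ?b => let a := reify_lterm R a env in let b := reify_lterm R b env in
               constr:(@LAdd R a b)
  | - ?a => let a := reify_lterm R a env in constr:(@LOpp R a)
  | ?c *: ?a => let a := reify_lterm R a env in constr:(@LScale R c a)
  | 0 => constr:(@LZero R)
  | _ => lazymatch atom_index t env with Some ?n => constr:(@LVar R n) end
  end.
Ltac module_over R V :=
  lazymatch goal with |- ?a = ?b =>
    let env := add_atoms a (@nil V) in
    let env := add_atoms b env in
    let t := reify_lterm R a env in
    let u := reify_lterm R b env in
    change (@leval R V env t = @leval R V env u);
    apply: leval_eq; rewrite /=; repeat split; lra
  end.
Ltac module :=
  lazymatch goal with |- @eq ?T _ _ =>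
    match goal with R : Real.type, V : GRing.Lmodule.type _ |- _ =>
      unify T (GRing.Lmodule.sort V); module_over R V
    end
  end.

(** Reduces a goal that follows from a combination [c = d] of hypotheses to an unconditional
    identity, which [module] checks. *)
Lemma linear_combination (V : zmodType) (a b c d : V) :
  c = d -> a - b = c - d -> a = b.
Proof. by move=> -> /eqP; rewrite subrr subr_eq0 => /eqP. Qed.

Lemma eqD (V : zmodType) (a b c d : V) : a = b -> c = d -> a + c = b + d.
Proof. by move=> -> ->. Qed.

Lemma eqZ (R : pzRingType) (V : lmodType R) (k : R) (a b : V) :
  a = b -> k *: a = k *: b.
Proof. by move=> ->. Qed.

Section Additive.
Context (R : realType) (X Y : lmodType R) (A : X -> Y) (addA : is_additive A).

Lemma additive0 : A 0 = 0.
Proof. by apply: (addrI (A 0)); rewrite -addA !addr0. Qed.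

Lemma additiveN x : A (- x) = - A x.
Proof. by apply/eqP; rewrite -addr_eq0 -addA addNr additive0. Qed.

Lemma additive_double x : A (2 *: x) = 2 *: A x.
Proof. by rewrite !scaler_nat !mulr2n addA. Qed.

End Additive.

(** * Iterated finite differences *)

Definition fdiff (X Y : zmodType) (h : X) (f : X -> Y) (x : X) : Y :=
  f (x + h) - f x.

Definition fdiffs (X Y : zmodType) (hs : seq X) (f : X -> Y) : X -> Y :=
  foldl (fun g h => fdiff h g) f hs.

Lemma fdiffE (X Y : zmodType) (h : X) (f : X -> Y) x :
  fdiff h f x = f (x + h) - f x.
Proof. by []. Qed.

Lemma fdiffC (X Y : zmodType) (h k : X) (f : X -> Y) :
  fdiff h (fdiff k f) = fdiff k (fdiff h f).
Proof.
apply/funext => x; rewrite /fdiff (addrAC x k h) !opprB.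
by rewrite [LHS]addrACA [RHS]addrACA [in RHS](addrC (- _)).
Qed.

(** Differences commute, so any increment can be carried to the front; induction then matches the
    two lists head by head. *)
Lemma perm_fdiffs (X Y : zmodType) (hs ks : seq X) (f : X -> Y) :
  perm_eq hs ks -> fdiffs hs f = fdiffs ks f.
Proof.
have rotate (s : seq X) u (g : X -> Y) :
    fdiffs (rcons s u) g = fdiffs (u :: s) g.
  elim: s g => //= v s IHs g; rewrite /fdiffs /= -!/(fdiffs _ _).
  by rewrite [LHS]IHs /fdiffs /= fdiffC.
elim: hs ks f => [|h hs IHhs] ks f.
  by rewrite perm_sym => /perm_nilP ->.
move=> /[dup] /perm_mem/(_ h); rewrite mem_head => /esym/splitPr[s t].
rewrite perm_sym -cat1s perm_catCA /= perm_cons perm_sym => /IHhs hsE.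
rewrite /fdiffs /= -!/(fdiffs _ _) hsE {1 2}/fdiffs !foldl_cat /=.
congr (foldl _ _ _); have /= := rotate s h f.
by rewrite /fdiffs -cats1 foldl_cat.
Qed.

(* Shifting [(x, y)] by [(h, - c *: h)] leaves [y + c *: x] fixed, so each
   difference removes one term of the sum. *)
Lemma fdiffs_eq0 (R : realType) (X Y : lmodType R) (s : seq (R * (X -> Y)))
    (f : X -> Y) (hs : seq X) (z : X) :
    (forall x y, f x = \sum_(p <- s) p.2 (y + p.1 *: x)) ->
  size hs = size s -> fdiffs hs f z = 0.
Proof.
elim: hs s f => [|h hs IHhs] [|[c g] s] f //= fE => [_|[size_hs]].
  by rewrite /fdiffs /= (fE z 0) big_nil.
rewrite /fdiffs /= -/(fdiffs _ _).
pose shift (p : R * (X -> Y)) := (p.1, fdiff ((p.1 - c) *: h) p.2).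
apply: (IHhs (map shift s)) => [x y|]; last by rewrite size_map.
rewrite fdiffE (fE _ (y - c *: h)) (fE x y) !big_cons /= big_map.
have -> : y - c *: h + c *: (x + h) = y + c *: x by module.
rewrite opprD addrACA subrr add0r -sumrB; apply: eq_bigr => p _.
by rewrite /= fdiffE; congr (p.2 _ - _); rewrite scalerDr; module.
Qed.

(** * Symmetric multi-additive forms and their diagonals *)

Lemma is_symmetric4_swaps (X : Type) (Y : Type) (B : X -> X -> X -> X -> Y) :
    is_symmetric4 B ->
  [/\ forall x y z w, B x y z w = B y x z w,
      forall y z x w, B x y z w = B x z y w &
      forall z w x y, B x y z w = B x y w z].
Proof.
move=> symB; pose v x y z w (i : 'I_4) : X := nth x [:: x; y; z; w] i.
(* Adjacent transpositions suffice to sort arguments by rewriting. Each conclusion quantifies the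
   swapped pair first, so that an instance fixes which two vectors are exchanged. *)
have swap i j x y z w := symB (tperm i j) (v x y z w).
split=> [x y z w|y z x w|z w x y].
- have := swap (inord 0) (inord 1) x y z w.
  by rewrite /apply4 /= tpermL tpermR !tpermD -?val_eqE /v /= ?inordK.
- have := swap (inord 1) (inord 2) x y z w.
  by rewrite /apply4 /= tpermL tpermR !tpermD -?val_eqE /v /= ?inordK.
- have := swap (inord 2) (inord 3) x y z w.
  by rewrite /apply4 /= tpermL tpermR !tpermD -?val_eqE /v /= ?inordK.
Qed.

Lemma quartic_form_add (R : realType) (X Y : lmodType R)
    (B : X -> X -> X -> X -> Y) x y :
    is_symmetric4 B -> is_multi_additive B ->
  B (x + y) (x + y) (x + y) (x + y) =
    B x x x x + 4 *: B x x x y + 6 *: B x x y y + 4 *: B x y y y + B y y y y.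
Proof.
move=> /is_symmetric4_swaps[C1 C2 C3] [B1 B2 B3 B4].
rewrite !(B1, B2, B3, B4) !(C1 y x, C2 y x, C3 y x); module.
Qed.

Lemma fdiffs_quartic_form (R : realType) (X Y : lmodType R)
    (B : X -> X -> X -> X -> Y) (A f : X -> Y) x y z w :
    is_symmetric4 B -> is_multi_additive B -> is_additive A ->
    (forall t, f t = B t t t t + A t) ->
  fdiffs [:: x; y; z; w] f 0 = 24 *: B x y z w.
Proof.
move=> symB mulB addA fE; have [C1 C2 C3] := is_symmetric4_swaps symB.
have DB a b := quartic_form_add a b symB mulB; have [B1 B2 B3 B4] := mulB.
pose BE := (B1, B2, B3, B4).
rewrite /fdiffs /=.
(* Each difference lowers the degree in [t] by one; [A] leaves the constant [A x] here and vanishes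
   from the next difference on. *)
have d1 t : fdiff x f t =
    4 *: B t t t x + 6 *: B t t x x + 4 *: B t x x x + B x x x x + A x.
  by rewrite fdiffE !fE DB addA; module.
have d2 t : fdiff y (fdiff x f) t =
    12 *: B t t x y + 12 *: B t x x y + 12 *: B t x y y
    + 4 *: B x x x y + 6 *: B x x y y + 4 *: B x y y y.
  rewrite fdiffE !d1 !BE.
  rewrite !(C1 y x, C2 y x, C3 y x, C1 y t, C2 y t, C3 y t).
  by module.
have d3 t : fdiff z (fdiff y (fdiff x f)) t =
    24 *: B t x y z + 12 *: B x x y z + 12 *: B x y y z + 12 *: B x y z z.
  rewrite fdiffE !d2 !BE.
  rewrite !(C1 z x, C2 z x, C3 z x, C1 z t, C2 z t, C3 z t).
  by rewrite !(C1 z y, C2 z y, C3 z y); module.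
rewrite fdiffE !d3 add0r (additive0 (B1 x y z)) (C1 w x) (C2 w y) (C3 w z).
module.
Qed.

(** The weight 3/7 is what balances the terms in [y] alone: [f (2 *: y) - 2 *: f y] kills [A] and
    equals 14 [B y y y y], so it contributes -6, and 8 - 6 = 2. *)
Lemma quartic_form_equation (R : realType) (X Y : lmodType R)
    (B : X -> X -> X -> X -> Y) (A : X -> Y) :
    is_symmetric4 B -> is_multi_additive B -> is_additive A ->
  functional_equation (fun x => B x x x x + A x).
Proof.
move=> symB mulB addA x y.
have DB a b := quartic_form_add a b symB mulB.
have [B1 B2 B3 B4] := mulB.
have N1 a b c d : B (- a) b c d = - B a b c d := additiveN (B1 b c d) a.
have N2 a b c d : B a (- b) c d = - B a b c d := additiveN (B2 a c d) b.
have N3 a b c d : B a b (- c) d = - B a b c d := additiveN (B3 a b d) c.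
have N4 a b c d : B a b c (- d) = - B a b c d := additiveN (B4 a b c) d.
have E1 a b c d : B (2 *: a) b c d = 2 *: B a b c d :=
  additive_double (B1 b c d) a.
have E2 a b c d : B a (2 *: b) c d = 2 *: B a b c d :=
  additive_double (B2 a c d) b.
have E3 a b c d : B a b (2 *: c) d = 2 *: B a b c d :=
  additive_double (B3 a b d) c.
have E4 a b c d : B a b c (2 *: d) = 2 *: B a b c d :=
  additive_double (B4 a b c) d.
rewrite !DB !(E1, E2, E3, E4) !(N1, N2, N3, N4) !addA.
by rewrite !(additive_double addA) !(additiveN addA); module.
Qed.

(** * Closure properties of the solution set *)

Lemma functional_equation_comb (R : realType) (X Y : lmodType R) (f g : X -> Y)
    (a b : R) :
    functional_equation f -> functional_equation g ->
  functional_equation (fun x => a *: f x + b *: g x).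
Proof.
move=> fE gE x y; have H := eqD (eqZ a (fE x y)) (eqZ b (gE x y)).
by apply: (linear_combination H); module.
Qed.

Lemma functional_equation_opp (R : realType) (X Y : lmodType R) (f : X -> Y) :
  functional_equation f -> functional_equation (fun x => f (- x)).
Proof.
move=> fE x y; have := fE (- x) (- y).
by rewrite !scalerN -!opprD.
Qed.

(** * Odd solutions *)

Section Odd.
Context (R : realType) (X Y : lmodType R) (f : X -> Y).
Hypotheses (fE : functional_equation f) (fN : forall x, f (- x) = - f x).

Let f_double x : f (2 *: x) = 2 *: f x.
Proof.
(* Subtracting the instance at [- x] cancels the terms in [f 0] and doubles the 3/7 term to 6/7. *)
have := eqZ (7 / 6) (eqD (fE 0 x) (eqZ (- 1) (fE 0 (- x)))).
rewrite !scaler0 !add0r !opprK !scalerN !fN => H.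
apply: (linear_combination H); module.
Qed.

Let sdiff x y := f (x + y) + f (x - y) - 2 *: f x.

Lemma odd_solution_additive : is_additive f.
Proof.
have sdiff_double x y : sdiff (2 *: x) y = 4 *: sdiff x y.
  have := fE x y; rewrite /sdiff !f_double => H.
  by apply: (linear_combination H); module.
have sdiff_scale x y : sdiff (2 *: x) (2 *: y) = 2 *: sdiff x y.
  by rewrite /sdiff -scalerDr -scalerBr !f_double; module.
have sdiff_half x y : sdiff x (2 *: y) = (1 / 2) *: sdiff x y.
  have H := eqD (sdiff_scale x y) (eqZ (- 1) (sdiff_double x (2 *: y))).
  by apply: (linear_combination (eqZ (1 / 4) H)); module.
have rec x y : sdiff (x + y) y + sdiff (x - y) y = (- (3 / 2)) *: sdiff x y.
  apply: (linear_combination (sdiff_half x y)); rewrite /sdiff.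
  have -> : x + y + y = x + 2 *: y by module.
  have -> : x - y - y = x - 2 *: y by module.
  by rewrite addrK subrK; module.
have sdiff0 x y : sdiff x y = 0.
  (* Adding the recurrences at [2 *: x + y] and [2 *: x - y], and using the one at [2 *: x], gives 4
     (t_1 + t_(-1)) + 8 t_0 = 9 t_0. The one at [x] makes the left side 2 t_0, so 7 t_0 = 0. *)
  have := rec (2 *: x + y) y; rewrite addrK.
  have := rec (2 *: x - y) y; rewrite subrK.
  have -> : 2 *: x + y + y = 2 *: (x + y) by module.
  have -> : 2 *: x - y - y = 2 *: (x - y) by module.
  have := rec (2 *: x) y; rewrite !sdiff_double => H1 H2 H3.
  have H := eqD (eqD H2 H3) (eqD (eqZ (- (3 / 2)) H1) (eqZ (- 4) (rec x y))).
  by apply: (linear_combination (eqZ (- (1 / 7)) H)); module.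
(* Centre at the midpoint of [x] and [y], with half their difference as increment. *)
move=> x y; have := sdiff0 ((1 / 2) *: (x + y)) ((1 / 2) *: (x - y)).
rewrite /sdiff -f_double.
have -> : 2 *: ((1 / 2) *: (x + y)) = x + y by module.
have -> : (1 / 2) *: (x + y) + (1 / 2) *: (x - y) = x by module.
have -> : (1 / 2) *: (x + y) - (1 / 2) *: (x - y) = y by module.
by move/eqP; rewrite subr_eq0 eq_sym => /eqP.
Qed.

End Odd.

(** * Even solutions *)

Section Even.
Context (R : realType) (X Y : lmodType R) (f : X -> Y).
Hypotheses (fE : functional_equation f) (fN : forall x, f (- x) = f x).

Let f0 : f 0 = 0.
Proof.
have := fE 0 0; rewrite !scaler0 !subr0 !addr0 => H.
by apply: (linear_combination (eqZ (- (7 / 3)) H)); module.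
Qed.

Let f_double x : f (2 *: x) = 16 *: f x.
Proof.
have := fE 0 x; rewrite !scaler0 !add0r fN f0 => H.
by apply: (linear_combination (eqZ (7 / 3) H)); module.
Qed.

Let f_triple x : f (3 *: x) = 81 *: f x.
Proof.
(* The coefficients give 64 - 6 + 32 - 8 - 1 = 81. *)
have := fE x x.
have -> : 2 *: x + x = 3 *: x by module.
have -> : 2 *: x - x = x by module.
have -> : x + x = 2 *: x by module.
rewrite subrr f0 !f_double => H.
by apply: (linear_combination H); module.
Qed.

Definition even_form (x y z w : X) : Y :=
  (1 / 24) *: fdiffs [:: x; y; z; w] f 0.

Let fdiffs5 (hs : seq X) x : size hs = 5 -> fdiffs hs f x = 0.
Proof.
pose s : seq (R * (X -> Y)) :=
  [:: (2, fun z => (1 / 24) *: f z); (- 2, fun z => (1 / 24) *: f z);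
      (1, fun z => (- (1 / 6)) *: f z); (- 1, fun z => (- (1 / 6)) *: f z);
      (0, fun z => (1 / 4) *: f z)].
(* The equation solved for [f x], with evenness putting every argument in
   the form [y + c *: x]. *)
apply: (@fdiffs_eq0 _ _ _ s) => {}x y; rewrite !big_cons big_nil /=.
have := fE x y; rewrite !f_double => H.
have -> : y + 2 *: x = 2 *: x + y by module.
have -> : y + (- 2) *: x = - (2 *: x - y) by module.
have -> : y + 1 *: x = x + y by module.
have -> : y + (- 1) *: x = - (x - y) by module.
have -> : y + 0 *: x = y by module.
by rewrite !fN; apply: (linear_combination (eqZ (- (1 / 24)) H)); module.
Qed.

Lemma perm_even_form x y z w x' y' z' w' :
    perm_eq [:: x; y; z; w] [:: x'; y'; z'; w'] ->
  even_form x y z w = even_form x' y' z' w'.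
Proof. by rewrite /even_form => /perm_fdiffs ->. Qed.

Lemma even_form_symmetric : is_symmetric4 even_form.
Proof.
move=> s v; apply: perm_even_form.
(* [apply4] reads a family in the order of [enum 'I_4], and composing with [s] only permutes that
   enumeration. *)
have codomE (u : 'I_4 -> X) :
    [:: u (inord 0); u (inord 1); u (inord 2); u (inord 3)] = map u (enum 'I_4).
  rewrite !enum_ordSl enum_ord0 /=.
  by do !congr (_ :: _); congr u; apply/val_inj; rewrite /= inordK.
rewrite !codomE map_comp; apply/perm_map/uniq_perm.
- by rewrite map_inj_uniq ?enum_uniq //; apply: perm_inj.
- exact: enum_uniq.
- move=> i; rewrite mem_enum -(permKV s i) mem_map ?mem_enum //.
  exact: perm_inj.
Qed.

Lemma even_form_multi_additive : is_multi_additive even_form.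
Proof.
(* The additivity defect in the last increment is a fifth difference at 0, up to the factor 1/24;
   rotating the arguments then transfers this to the other slots. *)
have add4 x y z : is_additive (even_form x y z).
  move=> v w; have := @fdiffs5 [:: x; y; z; w; v] 0 erefl.
  rewrite /even_form /fdiffs /= !fdiffE !add0r (addrC v w) => H.
  by apply: (linear_combination (eqZ (1 / 24) H)); module.
have C1 x y z w : even_form x y z w = even_form y z w x.
  by apply: perm_even_form; rewrite (perm_catC [:: x] [:: y; z; w]).
split=> a b c x y.
- by rewrite !(C1 _ a b c) add4.
- by rewrite !(C1 a) !(C1 _ b c a) add4.
- by rewrite -!(C1 c a b) add4.
- by rewrite add4.
Qed.

(** The binomial weights give 256 - 4 * 81 + 6 * 16 - 4 = 24. *)
Lemma even_form_diag x : even_form x x x x = f x.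
Proof.
rewrite /even_form /fdiffs /= !fdiffE !add0r.
have -> : x + x + x + x = 2 *: (2 *: x) by module.
have -> : x + x + x = 3 *: x by module.
have -> : x + x = 2 *: x by module.
by rewrite !(f_double, f_triple) f0; module.
Qed.

End Even.

(** * The equivalence, with existence and uniqueness of the pair *)

Theorem theorem2p2 (R : realType) (X Y : lmodType R) (f : X -> Y) :
  functional_equation f <->
  exists! BA : (X -> X -> X -> X -> Y) * (X -> Y),
    [/\ is_symmetric4 BA.1,
        is_multi_additive BA.1,
        is_additive BA.2 &
        forall x : X, f x = BA.1 x x x x + BA.2 x].
Proof.
split=> [fE|[[B A]] [[/= symB mulB addA fBA] _]]; last first.
  by rewrite (funext fBA); apply: quartic_form_equation.
have fNE := functional_equation_opp fE.
pose e x := (1 / 2) *: f x + (1 / 2) *: f (- x).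
pose o x := (1 / 2) *: f x + (- (1 / 2)) *: f (- x).
have eE : functional_equation e by exact: functional_equation_comb fE fNE.
have oE : functional_equation o by exact: functional_equation_comb fE fNE.
have eN x : e (- x) = e x by rewrite /e opprK; module.
have oN x : o (- x) = - o x by rewrite /o opprK; module.
have symB := even_form_symmetric e.
have mulB := even_form_multi_additive eE eN.
have addo := odd_solution_additive oE oN.
have fBo x : f x = even_form e x x x x + o x.
  by rewrite even_form_diag // /e /o; module.
exists (even_form e, o); split=> // -[B A] [/= symB' mulB' addA fBA].
(* Both forms, multiplied by 24, compute the same fourth difference of [f] at 0. *)
have BE : even_form e = B.
  apply/funext => x; apply/funext => y; apply/funext => z; apply/funext => w.
  have := fdiffs_quartic_form x y z w symB mulB addo fBo.
  rewrite (fdiffs_quartic_form x y z w symB' mulB' addA fBA) => H.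
  by apply: (linear_combination (eqZ (- (1 / 24)) H)); module.
congr pair => //; apply/funext => x; have := fBA x.
by rewrite fBo BE => /addrI.
Qed.
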